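(* Let $\Lambda$ be a set of $\mathit{LTL}$-formulas, $A$ an $\mathit{LTL}$-formula, and $\Lambda^*=\{B^*\mid B\in\Lambda\}$. Then $\Lambda\models_{\mathit{LTL}} A$ if and only if $\Lambda^*\models_{\nabla} A^*$.
   Context: Fix a set $\mathcal{P}$ of propositional symbols. $\mathit{LTL}$-formulas: $A ::= p \mid \bot \mid A\supset A \mid \mathsf{G}A \mid \mathsf{X}A \mid A\,\mathsf{U}\,A$ ($p\in\mathcal{P}$). $\mathit{LTL}_\nabla$-formulas: $A ::= p \mid \bot \mid A\supset A \mid \mathsf{G}A \mid \mathsf{X}A \mid \nabla A$. In both languages $\neg A := A\supset\bot$, $A\vee B := \neg A\supset B$, $A\wedge B := \neg(\neg A\vee\neg B)$, $\mathsf{F}A := \neg\mathsf{G}\neg A$. An $\mathit{LTL}$-model is $\mathcal{M}=\langle \mathbb{N},\mathcal{V}\rangle$ with $\mathcal{V}:\mathbb{N}\to 2^{\mathcal{P}}$. $\mathit{LTL}$-truth: $\mathcal{M},n\models_{\mathit{LTL}} p$ iff $p\in\mathcal{V}(n)$; $\bot$ never true; $\supset$ classical; $\mathcal{M},n\models_{\mathit{LTL}}\mathsf{G}A$ iff $\mathcal{M},m\models_{\mathit{LTL}} A$ for all $m\ge n$; $\mathcal{M},n\models_{\mathit{LTL}}\mathsf{X}A$ iff $\mathcal{M},n+1\models_{\mathit{LTL}} A$; $\mathcal{M},n\models_{\mathit{LTL}} A\,\mathsf{U}\,B$ iff there is $n'\ge n$ with $\mathcal{M},n'\models_{\mathit{LTL}}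 B$ and $\mathcal{M},m\models_{\mathit{LTL}} A$ for all $n\le m<n'$. $\mathcal{M}\models_{\mathit{LTL}}A$ iff $\mathcal{M},n\models_{\mathit{LTL}}A$ for all $n$; $\Lambda\models_{\mathit{LTL}}A$ iff for every $\mathit{LTL}$-model $\mathcal{M}$, if $\mathcal{M}\models_{\mathit{LTL}}B$ for all $B\in\Lambda$ then $\mathcal{M}\models_{\mathit{LTL}}A$. An observation sequence is a non-empty finite sequence $[n_0,\ldots,n_k]$ of natural numbers. Truth $\models_\nabla$ of $\mathit{LTL}_\nabla$-formulas at observation sequences: $\mathcal{M},[n_0,\ldots,n_k]\models_\nabla p$ iff $p\in\mathcal{V}(n_k)$; $\bot$ never true; $\supset$ classical at the same sequence; $\mathcal{M},[n_0,\ldots,n_k]\models_\nabla\mathsf{G}A$ iff $\mathcal{M},[n_0,\ldots,n_k,m]\models_\nabla A$ for all $m\ge n_k$; $\mathcal{M},[n_0,\ldots,n_k]\models_\nabla\mathsf{X}A$ iff $\mathcal{M},[n_0,\ldots,n_k,n_k+1]\models_\nabla A$; if $k>0$, $\mathcal{M},[n_0,\ldots,n_{k-1},n_k]\models_\nabla\nabla A$ iff $\mathcal{M},[n_0,\ldots,n_{k-1},m]\models_\nabla A$ for all $n_{k-1}\le m\le n_k$; and $\mathcal{M},[n_0]\models_\nabla\nabla A$ iff $\mathcal{M},[n_0]\models_\nabla A$. $\mathcal{M}\models_\nabla A$ iff $\mathcal{M},\sigma\models_\nabla A$ for every observation sequence $\sigma$; $\Gamma\models_\nabla A$ iff for every $\mathit{LTL}$-model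 $\mathcal{M}$, if $\mathcal{M}\models_\nabla B$ for all $B\in\Gamma$ then $\mathcal{M}\models_\nabla A$. The translation $(\cdot)^*$: $p^*=p$, $\bot^*=\bot$, $(A\supset B)^*=A^*\supset B^*$, $(\mathsf{G}A)^*=\mathsf{G}A^*$, $(\mathsf{X}A)^*=\mathsf{X}A^*$, $(A\,\mathsf{U}\,B)^* = B^*\vee \mathsf{F}(\mathsf{X}B^*\wedge\nabla A^* )$. *)

(* Defs.v *)
From mathcomp Require Import all_boot.
From mathcomp Require Import boolp classical_sets.

Set Implicit Arguments.
Unset Strict Implicit.
Unset Printing Implicit Defensive.

Local Open Scope classical_set_scope.

Inductive ltl (P : Type) : Type :=
| LVar of P
| LBot
| LImp of ltl P & ltl P
| LG of ltl P
| LX of ltl P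
| LU of ltl P & ltl P.

Arguments LBot {P}.

Inductive nltl (P : Type) : Type :=
| NVar of P
| NBot
| NImp of nltl P & nltl P
| NG of nltl P
| NX of nltl P
| NNabla of nltl P.

Arguments NBot {P}.

Definition NNeg (P : Type) (A : nltl P) : nltl P := NImp A NBot.
Definition NOr (P : Type) (A B : nltl P) : nltl P := NImp (NNeg A) B.
Definition NAnd (P : Type) (A B : nltl P) : nltl P :=
  NNeg (NOr (NNeg A) (NNeg B)).
Definition NF (P : Type) (A : nltl P) : nltl P := NNeg (NG (NNeg A)).

(* The frame is always nat, so a model is just its valuation. *)
Definition model (P : Type) : Type := nat -> set P.

Fixpoint ltl_sat (P : Type) (M : model P) (n : nat) (A : ltl P) : Prop :=
  match A with
  | LVar p => M n p
  | LBot => False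
  | LImp B C => ltl_sat M n B -> ltl_sat M n C
  | LG B => forall m, n <= m -> ltl_sat M m B
  | LX B => ltl_sat M n.+1 B
  | LU B C => exists n', [/\ n <= n', ltl_sat M n' C
                           & forall m, n <= m < n' -> ltl_sat M m B]
  end.

Definition ltl_true (P : Type) (M : model P) (A : ltl P) : Prop :=
  forall n, ltl_sat M n A.

Definition ltl_entails (P : Type) (L : set (ltl P)) (A : ltl P) : Prop :=
  forall M : model P, (forall B, L B -> ltl_true M B) -> ltl_true M A.

(* The observation sequence [n_0, ..., n_k] is given by its (possibly empty)
   prefix s = [:: n_0; ...; n_(k-1)] and its last entry n = n_k, so every pair
   (s, n) is a non-empty sequence; no monotonicity is required.  When
   s = x :: s', the entry n_(k-1) is last x s'. *)
Fixpoint nabla_sat (P : Type) (M : model P) (s : seq nat) (n : nat)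
    (A : nltl P) : Prop :=
  match A with
  | NVar p => M n p
  | NBot => False
  | NImp B C => nabla_sat M s n B -> nabla_sat M s n C
  | NG B => forall m, n <= m -> nabla_sat M (rcons s n) m B
  | NX B => nabla_sat M (rcons s n) n.+1 B
  | NNabla B =>
      if s is x :: s' then
        forall m, last x s' <= m <= n -> nabla_sat M s m B
      else nabla_sat M [::] n B
  end.

Definition nabla_true (P : Type) (M : model P) (A : nltl P) : Prop :=
  forall (s : seq nat) (n : nat), nabla_sat M s n A.

Definition nabla_entails (P : Type) (G : set (nltl P)) (A : nltl P) : Prop :=
  forall M : model P, (forall B, G B -> nabla_true M B) -> nabla_true M A.

Fixpoint star (P : Type) (A : ltl P) : nltl P :=
  match A with
  | LVar p => NVar p
  | LBot => NBot
  | LImp B C => NImp (star B) (star C)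
  | LG B => NG (star B)
  | LX B => NX (star B)
  | LU B C => NOr (star C) (NF (NAnd (NX (star C)) (NNabla (star B))))
  end.

(* Main.v *)
Require Import Defs.
From mathcomp Require Import all_boot.
From mathcomp Require Import boolp classical_sets.

Local Open Scope classical_set_scope.

(** The translation A^* does not see the past: its truth at an observation
    sequence depends only on the last entry n, where it coincides with the truth
    of A.  In the only case where [NNabla] occurs, it sits directly below an [F],
    which has just appended some m >= n to the sequence, so it quantifies over
    the interval [n, m]; a witness n' > n for A U B corresponds to m = n' - 1. *)

Section NablaConnectives.
Variables (P : Type) (M : model P).
Implicit Types (A B : nltl P) (s : seq nat) (n : nat).

Lemma nabla_sat_or s n A B :
  nabla_sat M s n (NOr A B) <-> nabla_sat M s n A \/ nabla_sat M s n B.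
Proof.
split=> [/= AB | [HA | HB] //= /(_ HA)//].
by have [HA | nA] := pselect (nabla_sat M s n A); [left | right; apply: AB].
Qed.

Lemma nabla_sat_and s n A B :
  nabla_sat M s n (NAnd A B) <-> nabla_sat M s n A /\ nabla_sat M s n B.
Proof.
split=> [/= AB | [HA HB] /= nAB]; last by apply: nAB => // nA; apply: nA.
by split; apply: contrapT => nH; apply: AB => nnA nB //; apply: nnA.
Qed.

Lemma nabla_sat_F s n A :
  nabla_sat M s n (NF A) <->
  exists2 m, n <= m & nabla_sat M (rcons s n) m A.
Proof.
split=> [/= FA | [m nm HA] /= nA]; last exact: nA m nm HA.
by apply: contrapT => nA; apply: FA => m nm HA; apply: nA; exists m.
Qed.

(** A prefix ending in [k] is non-empty, so the separate clause for one-entry sequences never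
    applies. *)
Lemma nabla_sat_nabla_rcons s k n A :
  nabla_sat M (rcons s k) n (NNabla A) <->
  forall m, k <= m <= n -> nabla_sat M (rcons s k) m A.
Proof. by case: s => [|x s] //=; rewrite last_rcons. Qed.

End NablaConnectives.

Lemma nabla_sat_star (P : Type) (M : model P) (A : ltl P) s n :
  nabla_sat M s n (star A) <-> ltl_sat M n A.
Proof.
(* [s] is generalized because the temporal clauses use the hypotheses at the longer prefix
   [rcons s n]. *)
elim: A s n => [p||B IHB C IHC|B IHB|B IHB|B IHB C IHC] s n //.
- by split=> /= H /IHB HB; apply/IHC/H.
- by split=> /= H m /H HB; apply/IHB/HB.
- exact: IHB.
rewrite [star _]/= nabla_sat_or nabla_sat_F; split.
- case=> [/IHC HC | [m nm /nabla_sat_and[/IHC HC /nabla_sat_nabla_rcons HB]]].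
    by exists n; split=> // m /andP[nm]; rewrite ltnNge nm.
  (* By conversion, [n <= j < m.+1] is the closed range [n <= j <= m] over which [NNabla]
     quantifies. *)
  by exists m.+1; split=> [||j jm]; [exact: leqW | | apply/IHB/HB].
- case=> n'; rewrite leq_eqVlt => -[/predU1P[<- | ]].
    by left; apply/IHC.
  case: n' => // m nm HC HB; right; exists m => //.
  apply/nabla_sat_and; split; first exact/IHC.
  by apply/nabla_sat_nabla_rcons => j jm; apply/IHB/HB.
Qed.

Lemma nabla_true_star (P : Type) (M : model P) (A : ltl P) :
  nabla_true M (star A) <-> ltl_true M A.
Proof.
split=> [H n | H s n]; last exact/nabla_sat_star.
(* Any prefix would do here; the empty one is chosen. *)
exact/nabla_sat_star/(H [::]).
Qed.

Theorem theorem1 (P : Type) (Lambda : set (ltl P)) (A : ltl P) :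
  ltl_entails Lambda A <->
  nabla_entails [set star B | B in Lambda] (star A).
Proof.
split=> H M HL.
  by apply/nabla_true_star/H => B LB; apply/nabla_true_star/HL; exists B.
by apply/nabla_true_star/H => _ [B LB <-]; apply/nabla_true_star/HL.
Qed.
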